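(* Let $1\le k\le n$ be integers. In the Hausdorff topology, $$\mathrm{Gr}(k,n)_{\ge 0}\;=\;\overline{\mathrm{Gr}(k,n)_{>0}}\;=\;\overline{e_{[k]}\cdot \mathrm{GL}(n)_{\ge 0}}.$$
   Context: $\mathrm{Gr}(k,n)$ is the Grassmannian of $k$-dimensional subspaces of $\mathbb{C}^n$; a point $X$ is represented as the row span of a full rank $k\times n$ matrix, and for a $k$-element subset $I\subset[n]=\{1,\dots,n\}$, $\Delta_I(X)$ is the $k\times k$ minor with columns $I$ (Plücker coordinates, well defined up to a common nonzero scalar). $\mathrm{Gr}(k,n)_{\ge 0}$ (resp. $\mathrm{Gr}(k,n)_{>0}$) is the set of points that can be represented by Plücker coordinates that are all nonnegative (resp. all positive) real numbers. $\mathrm{GL}(n)_{\ge 0}$ is the set of real invertible $n\times n$ matrices all of whose minors (of every size) are nonnegative. $\mathrm{GL}(n)$ acts on $\mathrm{Gr}(k,n)$ on the right by matrix multiplication, and $e_{[k]}=\mathrm{span}(e_1,\dots,e_k)\in\mathrm{Gr}(k,n)$, where $e_1,\dots,e_n$ is the standard basis. *)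

(* Defs.v *)
From HB Require Import structures.
From mathcomp Require Import all_boot all_order all_algebra.
From mathcomp Require Import all_classical all_reals all_analysis.
From mathcomp Require Export complex.

Set Implicit Arguments.
Unset Strict Implicit.
Unset Printing Implicit Defensive.

Import Order.TTheory GRing.Theory Num.Theory.
Import numFieldNormedType.Exports.

Local Open Scope classical_set_scope.
Local Open Scope ring_scope.

Record Gr (K : fieldType) (k n : nat) : Type := MkGr {
  gr_vs :> {vspace 'rV[K]_n};
  dim_gr : \dim gr_vs == k }.

HB.instance Definition _ (K : fieldType) (k n : nat) :=
  [isSub for @gr_vs K k n].
HB.instance Definition _ (K : fieldType) (k n : nat) :=
  [Choice of Gr K k n by <:].

Definition full_rank_mx (K : fieldType) (k n : nat) : set 'M[K]_(k, n) :=
  [set A | row_free A].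
Arguments full_rank_mx : clear implicits.

Definition row_span (K : fieldType) (k n : nat) (A : 'M[K]_(k, n)) :
  {vspace 'rV[K]_n} := <<[seq row i A | i : 'I_k]>>%VS.

Lemma dim_row_span (K : fieldType) (k n : nat) (A : full_rank_mx K k n) :
  \dim (row_span (val A)) == k.
Proof.
case: A => A /= /set_mem; rewrite /full_rank_mx /= => Afree.
have -> : row_span A = <<[tuple row i A | i < k]>>%VS by [].
suff: free [tuple row i A | i < k] by rewrite /free size_tuple.
apply/freeP => c c0 i; have : (\row_j c j) *m A = 0.
  rewrite mulmx_sum_row -[RHS]c0; apply: eq_bigr => j _.
  by rewrite mxE -tnth_nth tnth_mktuple.
move/(canRL (mulmxKp Afree)); rewrite mul0mx => /rowP/(_ i).
by rewrite !mxE.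
Qed.

Definition gr_span (K : fieldType) (k n : nat) (A : full_rank_mx K k n) :
  Gr K k n := MkGr (dim_row_span A).

(* The classical (Hausdorff) topology on the Grassmannian: the quotient topology
   along [gr_span], where full rank matrices carry the subspace topology
   inherited from ['M[K]_(k, n)]. *)
Definition Gr_open (K : numFieldType) (k n : nat) (S : set (Gr K k n)) : Prop :=
  open (@gr_span K k n @^-1` S).

Section GrTopology.
Context (K : numFieldType) (k n : nat).

Let Gr_openT : Gr_open [set: Gr K k n].
Proof. by rewrite /Gr_open preimage_setT; exact: openT. Qed.

Let Gr_openI : setI_closed (@Gr_open K k n).
Proof. by move=> S T; exact: openI. Qed.

Let Gr_open_bigU (I : Type) (f : I -> set (Gr K k n)) :
  (forall i, Gr_open (f i)) -> Gr_open (\bigcup_i f i).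
Proof. by move=> fo; apply: bigcup_open => i _; exact: fo. Qed.

HB.instance Definition _ :=
  @isOpenTopological.Build (Gr K k n) (@Gr_open K k n)
    Gr_openT Gr_openI Gr_open_bigU.

End GrTopology.

(* The [j]-th smallest element of the [m]-element set [I]. *)
Definition subset_nth (n m : nat) (I : {set 'I_n}) (hI : #|I| = m) (j : 'I_m) :
  'I_n := enum_val (cast_ord (esym hI) j).

Definition minor (K : fieldType) (p q m : nat) (A : 'M[K]_(p, q))
    (I : {set 'I_p}) (hI : #|I| = m) (J : {set 'I_q}) (hJ : #|J| = m) : K :=
  \det (mxsub (subset_nth hI) (subset_nth hJ) A).

Definition plucker (K : fieldType) (k n : nat) (A : 'M[K]_(k, n))
    (I : {set 'I_n}) (hI : #|I| = k) : K :=
  \det (colsub (subset_nth hI) A).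

(* Plücker coordinates of a point are defined up to the common scalar [c].
   In [R[i]], [0 <= z] (resp. [0 < z]) says that [z] is real and nonnegative
   (resp. positive). *)
Definition Gr_ge0 (K : numFieldType) (k n : nat) : set (Gr K k n) :=
  [set X | exists (A : full_rank_mx K k n) (c : K),
     [/\ X = gr_span A, c != 0 &
         forall (I : {set 'I_n}) (hI : #|I| = k), 0 <= c * plucker (val A) hI]].

Definition Gr_gt0 (K : numFieldType) (k n : nat) : set (Gr K k n) :=
  [set X | exists (A : full_rank_mx K k n) (c : K),
     [/\ X = gr_span A, c != 0 &
         forall (I : {set 'I_n}) (hI : #|I| = k), 0 < c * plucker (val A) hI]].

Definition GL_ge0 (R : realFieldType) (n : nat) : set 'M[R]_n :=
  [set g | g \in unitmx /\
     forall (m : nat) (I J : {set 'I_n}) (hI : #|I| = m) (hJ : #|J| = m),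
       0 <= minor g hI hJ].

Definition gr_act_vs (K : fieldType) (n : nat) (U : {vspace 'rV[K]_n})
    (g : 'M[K]_n) : {vspace 'rV[K]_n} := (linfun (mulmxr g) @: U)%VS.

Definition e_span (K : fieldType) (k n : nat) : {vspace 'rV[K]_n} :=
  <<[seq delta_mx 0%R i | i in [pred i : 'I_n | (i < k)%N]]>>%VS.

(* For [k <= n] the translate of [e_span] by an invertible [g] has dimension [k],
   hence is the subspace underlying exactly one point of the Grassmannian. *)
Definition e_GL_ge0 (R : rcfType) (k n : nat) : set (Gr R[i] k n) :=
  [set X | exists2 g : 'M[R]_n, GL_ge0 g &
     gr_vs X = gr_act_vs (e_span R[i] k n) (map_mx (real_complex R) g)].

(* Main.v *)
Require Import Defs.
From mathcomp Require Import all_boot all_order all_algebra.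
From mathcomp Require Import fingroup perm.
From mathcomp Require Import all_classical all_reals all_analysis.
From mathcomp Require Import zify lra.
Import Order.TTheory GRing.Theory Num.Theory.
Import numFieldNormedType.Exports.

Set Implicit Arguments.
Unset Strict Implicit.
Unset Printing Implicit Defensive.

Local Open Scope classical_set_scope.
Local Open Scope ring_scope.

(** Write Gr_ge0, Gr_gt0 and E for the three sets; the theorem follows from four
    facts.

    - Gr_ge0 is closed ([closed_Gr_ge0]): having all Plücker coordinates on one
      complex ray means that |x| y = |y| x for every two coordinates x and y,
      and this is a closed condition on a representing matrix.
    - E lies in Gr_ge0 ([e_GL_ge0_sub_Gr_ge0]): the Plücker coordinates of
      e_[k] g are the minors of g in its first k rows.
    - Gr_ge0 lies in the closure of Gr_gt0 ([Gr_ge0_sub_closure_gt0]).  For small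
      q > 0 the matrix h(q) with entries q^((i-j)^2) is totally positive: by the
      rearrangement inequality the diagonal product is the unique term of lowest
      degree in each minor.  By Cauchy-Binet, right multiplication by h(q) turns
      nonnegative Plücker coordinates into positive ones, and h(q) tends to the
      identity as q tends to 0.
    - Gr_gt0 lies in the closure of E ([Gr_gt0_sub_closure_e_GL]).

    For the last fact, a point X of Gr_gt0 has a real representative A0 = (B | 1)
    ending in an identity block.  Complete it below to the square matrix
    M = (B, 1 ; (-1)^k, 0).  Its flag minors, those in rows 1..m for any m, are
    all nonnegative: the one in columns J is zero or a Plücker coordinate of A0,
    whose index is J enlarged by the last k - m columns if m <= k, and J without
    the first m - k columns if m >= k.  So M h(q) has positive flag minors by
    Cauchy-Binet.  A lower triangular L(t) with entries t^(j (n-i)), indices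
    starting at 0, then makes every minor of L(t) M h(q) positive for small t > 0,
    because in each minor the unique term of lowest degree in t is a flag minor of M h(q).
    Being lower triangular, L(t) preserves the span of the first k rows; hence
    X h(q) belongs to E, and X h(q) tends to X.

    Minors are indexed throughout by strictly increasing maps of ordinals instead
    of subsets; [subset_nth_imset] and [subset_nth_increasing] give the
    translation. *)

(** * Increasing maps between ordinals *)

Definition increasing (m n : nat) (s : 'I_m -> 'I_n) : Prop :=
  forall a b : 'I_m, (a < b)%N -> (s a < s b)%N.

Lemma increasing_inj m n (s : 'I_m -> 'I_n) : increasing s -> injective s.
Proof.
move=> sI a b sab; apply: val_inj; case: (ltngtP a b) => // [/sI|/sI];
  by rewrite sab ltnn.
Qed.

Lemma increasing_geq m n (s : 'I_m -> 'I_n) (a : 'I_m) :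
  increasing s -> (a <= s a)%N.
Proof.
case: a => a; elim: a => //= a IH am sI.
have am' : (a < m)%N by exact: ltnW.
by apply: leq_ltn_trans (IH am' sI) (sI _ _ _).
Qed.

Lemma increasing_leq m n (s : 'I_m -> 'I_n) : increasing s -> (m <= n)%N.
Proof. by move=> /increasing_inj/leq_card; rewrite !card_ord. Qed.

Lemma increasing_bound m n (s : 'I_m -> 'I_n) (a : 'I_m) :
  increasing s -> (s a + (m - a) <= n)%N.
Proof.
move=> sI; have [d] := ubnP (m - a); elim: d a => // d IH a.
have [am|] := ltnP a.+1 m; last first.
  by have := ltn_ord a; have := ltn_ord (s a); lia.
have /= := IH (Ordinal am); have /= := sI a (Ordinal am) (ltnSn _).
by have := ltn_ord a; lia.
Qed.

Lemma increasing_endo m (s : 'I_m -> 'I_m) : increasing s -> s =1 id.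
Proof.
move=> sI a; apply: val_inj => /=.
by have := increasing_geq a sI; have := increasing_bound a sI; lia.
Qed.

(** Matching each value of [s] with its position in [t] gives an increasing
    self-map of ['I_m], which must be the identity. *)
Lemma increasing_comp_eq m n (s t : 'I_m -> 'I_n) :
  increasing s -> increasing t -> (forall a, exists b, s a = t b) -> s =1 t.
Proof.
move=> sI tI /fin_all_exists[p sp] a.
suff pI : increasing p by rewrite sp (increasing_endo pI).
move=> b c bc; have := sI _ _ bc; rewrite !sp => tbc.
case: (ltngtP (p b) (p c)) => // [/tI|/val_inj pbc]; first by lia.
by rewrite pbc ltnn in tbc.
Qed.

(** [subset_nth] reads off [enum], which lists an ordinal type in order. *)
Lemma subset_nth_increasing n m (I : {set 'I_n}) (hI : #|I| = m) :
  increasing (subset_nth hI).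
Proof.
have srt : sorted (relpre val ltn) (enum I).
  rewrite -sorted_map -[enum _](eq_filter (mem_enum _)).
  rewrite -(eq_filter (mem_map val_inj _)) -filter_map.
  by rewrite (sorted_filter ltn_trans) // unlock val_ord_enum iota_ltn_sorted.
move=> a b ab; rewrite /subset_nth !(enum_val_nth (subset_nth hI a)) /=.
apply: (@sorted_ltn_nth _ (relpre val ltn)) => //.
- by move=> x y z /=; apply: ltn_trans.
- by rewrite inE -cardE hI.
- by rewrite inE -cardE hI.
Qed.

Lemma subset_nth_surj n m (I : {set 'I_n}) (hI : #|I| = m) x :
  x \in I -> exists a, x = subset_nth hI a.
Proof.
move=> xI; exists (cast_ord hI (enum_rank_in xI x)).
by rewrite /subset_nth cast_ordK enum_rankK_in.
Qed.

Lemma card_imset_ord m n (s : 'I_m -> 'I_n) :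
  injective s -> #|(s @: 'I_m)%SET| = m.
Proof. by move=> sI; rewrite card_imset // card_ord. Qed.

Lemma subset_nth_imset m n (s : 'I_m -> 'I_n) (sI : increasing s) :
  subset_nth (card_imset_ord (increasing_inj sI)) =1 s.
Proof.
move=> a; apply/esym; move: a; apply: increasing_comp_eq => //.
  exact: subset_nth_increasing.
by move=> a; apply/subset_nth_surj/imset_f.
Qed.

Lemma injective_sort m n (f : 'I_m -> 'I_n) : injective f ->
  exists (s : 'I_m -> 'I_n) (p : 'S_m), increasing s /\ f =1 s \o p.
Proof.
move=> fI; pose hI := card_imset_ord fI.
have /fin_all_exists[p fp] : forall a, exists b, f a = subset_nth hI b.
  by move=> a; apply/subset_nth_surj/imset_f.
have pI : injective p by move=> a b pab; apply: (fI); rewrite !fp pab.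
exists (subset_nth hI), (perm pI); split; first exact: subset_nth_increasing.
by move=> a /=; rewrite permE.
Qed.

(** * Minors and the Cauchy-Binet formula *)

Lemma rowsub_colsub (T : Type) p m n (A : 'M[T]_(p, n)) (r : 'I_m -> 'I_p)
    (s : 'I_m -> 'I_n) : rowsub r (colsub s A) = mxsub r s A.
Proof. by apply/matrixP => i j; rewrite !mxE. Qed.

Lemma colsub_rowsub (T : Type) p m n (A : 'M[T]_(p, n)) (r : 'I_m -> 'I_p)
    (s : 'I_m -> 'I_n) : colsub s (rowsub r A) = mxsub r s A.
Proof. by apply/matrixP => i j; rewrite !mxE. Qed.

(** Multilinearity in the rows; the maps [f] need not be injective, which makes
    the sum easy to reindex. *)
Lemma det_mulmx_sum (R : comPzRingType) m n (A : 'M[R]_(m, n)) (B : 'M[R]_(n, m)) :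
  \det (A *m B) =
  \sum_(f : {ffun 'I_m -> 'I_n}) (\prod_i A i (f i)) * \det (rowsub f B).
Proof.
transitivity (\sum_(f : {ffun 'I_m -> 'I_n}) \sum_(s : 'S_m)
    (-1) ^+ s * \prod_i (A i (f i) * B (f i) (s i))).
  rewrite exchange_big /= /determinant; apply: eq_bigr => /= s _.
  rewrite -big_distrr /=.
  congr (_ * _); rewrite -(bigA_distr_bigA (fun i j => A i j * B j (s i))) /=.
  by apply: eq_bigr => x _; rewrite mxE.
apply: eq_bigr => f _; rewrite mulr_sumr; apply: eq_bigr => s _.
rewrite big_split /= mulrCA; congr (_ * (_ * _)).
by apply: eq_bigr => i _; rewrite mxE.
Qed.

Lemma det_rowsub_perm (R : comPzRingType) m n (B : 'M[R]_(n, m))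
    (s : 'I_m -> 'I_n) (p : 'S_m) :
  \det (rowsub (s \o p) B) = (-1) ^+ p * \det (rowsub s B).
Proof.
rewrite -det_perm -det_mulmx -row_permE; congr (\det _).
by apply/matrixP => i j; rewrite !mxE.
Qed.

Lemma det_colsub_perm (R : comPzRingType) m n (A : 'M[R]_(m, n))
    (s : 'I_m -> 'I_n) (p : 'S_m) :
  \det (colsub (s \o p) A) = (-1) ^+ p * \det (colsub s A).
Proof.
have E f : colsub f A = (rowsub f A^T)^T by apply/matrixP => i j; rewrite !mxE.
by rewrite !E !det_tr det_rowsub_perm.
Qed.

Lemma det_rowsub_noninj (R : comPzRingType) m n (B : 'M[R]_(n, m))
    (f : 'I_m -> 'I_n) : ~ injective f -> \det (rowsub f B) = 0.
Proof.
move=> /injectiveP/injectivePn[a [b ab fab]].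
by apply: (determinant_alternate ab) => j; rewrite !mxE fab.
Qed.

Lemma det_colsub_noninj (R : comPzRingType) m n (A : 'M[R]_(m, n))
    (f : 'I_m -> 'I_n) : ~ injective f -> \det (colsub f A) = 0.
Proof.
have -> : colsub f A = (rowsub f A^T)^T by apply/matrixP => i j; rewrite !mxE.
by move=> fI; rewrite det_tr det_rowsub_noninj.
Qed.

(** Each [m]-element set of columns contributes [m`!] equal terms on the right,
    one for each ordering of it, and repeated columns contribute nothing. *)
Lemma cauchy_binet (R : comPzRingType) m n (A : 'M[R]_(m, n)) (B : 'M[R]_(n, m)) :
  (m`!)%:R * \det (A *m B) =
  \sum_(f : {ffun 'I_m -> 'I_n}) \det (colsub f A) * \det (rowsub f B).
Proof.
transitivity (\sum_(p : 'S_m) \det (A *m B)).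
  by rewrite big_const cardT -cardE card_Sn iter_addr_0 mulr_natl.
under [RHS]eq_bigr => f _ do rewrite mulr_suml.
rewrite [RHS]exchange_big /=; apply: eq_bigr => p _.
rewrite det_mulmx_sum
  (reindex (fun f : {ffun 'I_m -> 'I_n} => [ffun a => f (p a)])).
  apply: eq_bigr => f _.
  have -> : rowsub [ffun a => f (p a)] B = rowsub (f \o p) B.
    by apply/matrixP => i j; rewrite !mxE ffunE.
  rewrite det_rowsub_perm mulrCA mulrA; congr (_ * _ * _).
  by apply: eq_bigr => i _; rewrite !mxE ffunE.
exists (fun f : {ffun 'I_m -> 'I_n} => [ffun a => f ((p^-1)%g a)]) => f _;
  by apply/ffunP => a; rewrite !ffunE ?permK ?permKV.
Qed.

(** In [cauchy_binet] the sign of the permutation that sorts [f] occurs twice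
    in each term, so that every term is a product of sorted minors. *)
Lemma det_mulmx_gt0 (R : numFieldType) m n (c : R) (A : 'M[R]_(m, n))
    (B : 'M[R]_(n, m)) (f : 'I_m -> 'I_n) :
  (forall s, increasing s -> 0 <= c * \det (colsub s A)) ->
  (forall s, increasing s -> 0 < \det (rowsub s B)) ->
  c != 0 -> \det (colsub f A) != 0 -> 0 < c * \det (A *m B).
Proof.
move=> A0 B0 c0 Af.
have term (g : 'I_m -> 'I_n) : injective g -> exists2 s, increasing s &
    c * (\det (colsub g A) * \det (rowsub g B)) =
    c * \det (colsub s A) * \det (rowsub s B) /\
    (\det (colsub g A) != 0 -> \det (colsub s A) != 0).
  move=> /injective_sort[s [p [sI gE]]]; exists s => //.
  have -> : colsub g A = colsub (s \o p) A.
    by apply/matrixP => i j; rewrite !mxE gE.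
  have -> : rowsub g B = rowsub (s \o p) B.
    by apply/matrixP => i j; rewrite !mxE gE.
  rewrite det_colsub_perm det_rowsub_perm mulrACA -expr2 sqrr_sign mul1r mulrA.
  by split=> //; rewrite mulf_eq0 signr_eq0.
have fI : injective f.
  by apply/injectiveP; apply: contraNT Af => /injectiveP fI;
    rewrite det_colsub_noninj.
have mf : 0 < (m`!)%:R :> R by rewrite ltr0n fact_gt0.
rewrite -(pmulr_rgt0 _ mf) mulrCA cauchy_binet mulr_sumr.
rewrite (bigD1 (finfun f)) //= ltr_wpDr //.
  apply: sumr_ge0 => g _.
  have [/injectiveP gI|/injectiveP gI] := boolP (injectiveb g).
    have [s sI [-> _]] := term _ gI.
    by rewrite mulr_ge0 ?A0 // ltW // B0.
  by rewrite det_colsub_noninj // mul0r mulr0.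
have -> : colsub (finfun f) A = colsub f A.
  by apply/matrixP => i j; rewrite !mxE ffunE.
have -> : rowsub (finfun f) B = rowsub f B.
  by apply/matrixP => i j; rewrite !mxE ffunE.
have [s sI [-> /(_ Af) sA]] := term _ fI.
by rewrite mulr_gt0 ?B0 // lt_def mulf_neq0 // A0.
Qed.

(** * Terms of lowest degree *)

(** A permutation other than the identity has an inversion, and undoing it
    increases the sum; so a maximizing permutation is the identity. *)
Lemma rearrangement_lt m (x y : 'I_m -> nat) (p : 'S_m) :
  (forall a b : 'I_m, (a < b)%N -> (x a < x b)%N) ->
  (forall a b : 'I_m, (a < b)%N -> (y a < y b)%N) ->
  p != 1%g -> (\sum_a x a * y (p a) < \sum_a x a * y a)%N.
Proof.
move=> xI yI; pose F (p : 'S_m) := (\sum_a x a * y (p a))%N.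
have swap q : q != 1%g -> exists q', (F q < F q')%N.
  move=> q1.
  suff [a [b [ab qab]]] : exists a b : 'I_m, (a < b)%N /\ (q b < q a)%N.
    exists (tperm a b * q)%g; rewrite /F.
    have ba : b != a by apply: contraTneq ab => ->; rewrite ltnn.
    have split (z : 'S_m) : (\sum_a x a * y (z a) = x a * y (z a) + (x b * y (z b)
        + \sum_(c | (c != a) && (c != b)) x c * y (z c)))%N.
      by rewrite (bigD1 a) //= (bigD1 b).
    rewrite !split !permM tpermL tpermR.
    rewrite [X in (_ < _ + (_ + X))%N](eq_bigr (fun c => x c * y (q c))%N);
      last first.
      by move=> c /andP[ca cb]; rewrite permM tpermD // eq_sym.
    rewrite !addnA ltn_add2r; have := xI _ _ ab; have := yI _ _ qab; nia.
  apply: contrapT => /forallNP qN; case/eqP: q1; apply/permP => a.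
  rewrite perm1; apply: (@increasing_endo _ q) => b c bc.
  case: (ltngtP (q b) (q c)) => // [qcb|/val_inj/perm_inj E].
    by case: (qN b); exists c.
  by rewrite E ltnn in bc.
move=> /swap[q pq]; apply: leq_trans pq _.
case: (@arg_maxnP _ q xpredT F) => // q0 _ q0max.
have [q01|/swap[q' ?]] := eqVneq q0 1%g; last first.
  by have := q0max q' isT; rewrite /geq /=; lia.
have := q0max q isT; rewrite /geq /= q01 {2}/F.
by under [X in (_ <= X)%N -> _]eq_bigr do rewrite perm1.
Qed.

(** Sorting the values of [f] lowers the sum by the rearrangement inequality, as
    the weights decrease, and the sorted values are bounded below by the
    positions. *)
Lemma sum_weight_lt m n (r f : 'I_m -> 'I_n) :
  increasing r -> injective f -> (exists a, f a != a :> nat) ->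
  (\sum_(a < m) a * (n - r a) < \sum_(a < m) f a * (n - r a))%N.
Proof.
move=> rI fI [a0 fa0]; have [s [p [sI fE]]] := injective_sort fI.
have split (g : 'I_m -> nat) :
    (\sum_(a < m) g a * (n - r a) + \sum_(a < m) r a * g a =
     \sum_(a < m) g a * n)%N.
  rewrite -big_split /=; apply: eq_bigr => a _.
  by rewrite mulnBr [(r a * _)%N]mulnC subnK // leq_mul2l ltnW ?orbT.
have le1 : (\sum_(a < m) a * (n - r a) <= \sum_(a < m) s a * (n - r a))%N.
  by apply: leq_sum => a _; rewrite leq_mul2r increasing_geq ?orbT.
have sumE : (\sum_(a < m) f a * n = \sum_(a < m) s a * n)%N.
  by rewrite [RHS](reindex_perm p); apply: eq_bigr => a _; rewrite fE.
have sp := split (fun a => f a); have ss := split (fun a => s a).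
rewrite -sumE in ss; rewrite /= in sp ss.
have [p1|p1] := eqVneq p 1%g; last first.
  apply: leq_ltn_trans le1 _.
  have := rearrangement_lt (x := fun a => r a) (y := fun a => s a) rI sI p1.
  have -> : (\sum_a r a * s (p a) = \sum_a r a * f a)%N.
    by apply: eq_bigr => a _; rewrite fE.
  move=> /= rs; move: sp ss rs; lia.
have fs a : f a = s a by rewrite fE /= p1 perm1.
under [X in (_ < X)%N]eq_bigr do rewrite fs.
rewrite (bigD1 a0) //= [X in (_ < X)%N](bigD1 a0) //=.
rewrite -addSn leq_add //; last first.
  by apply: leq_sum => a _; rewrite leq_mul2r increasing_geq ?orbT.
rewrite ltn_mul2r subn_gt0 ltn_ord /= ltn_neqAle increasing_geq // andbT.
by rewrite -fs eq_sym.
Qed.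

(** For [q < 1] the other terms are bounded in absolute value by [S * q] times
    [q ^+ e t0], where [S] is the sum of the [`|c t|]. *)
Lemma leading_term_gt0 (R : realType) (T : finType) (c : T -> R) (e : T -> nat)
    (t0 : T) :
  0 < c t0 -> (forall t, t != t0 -> c t != 0 -> (e t0 < e t)%N) ->
  \forall q \near 0^'+, 0 < \sum_t c t * q ^+ e t.
Proof.
move=> c0 ce; set S := \sum_t `|c t|.
have S0 : 0 <= S by apply: sumr_ge0.
have d0 : 0 < c t0 / (1 + S) by rewrite divr_gt0 // ltr_pwDl.
near=> q.
have q0 : 0 < q by near: q; exact: nbhs_right_gt.
have q1 : q < 1 by near: q; exact: nbhs_right_lt.
have qd : q < c t0 / (1 + S) by near: q; exact: nbhs_right_lt.
rewrite (bigD1 t0) //= -ltrBlDr sub0r.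
apply: (@le_lt_trans _ _ (S * q ^+ (e t0).+1)).
  rewrite -sumrN mulr_suml [leRHS](bigD1 t0) //= ler_wpDl //.
    by rewrite mulr_ge0 // exprn_ge0 // ltW.
  apply: ler_sum => t tt0; rewrite -mulNr.
  have [->|ct] := eqVneq (c t) 0; first by rewrite normr0 oppr0 !mul0r.
  apply: (@le_trans _ _ (`|c t| * q ^+ e t)).
    apply: ler_wpM2r; first by rewrite exprn_ge0 // ltW.
    by rewrite -(normrN (c t)) ler_norm.
  by apply: ler_wpM2l => //; apply: ler_wiXn2l; rewrite ?ltW ?ce.
rewrite exprS mulrA ltr_pM2r ?exprn_gt0 //.
rewrite ltr_pdivlMr ?ltr_pwDl // in qd.
by apply: le_lt_trans qd; nra.
Unshelve. all: by end_near. Qed.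

(** * Totally positive families *)

Definition totally_positive (R : numDomainType) (n : nat) (g : 'M[R]_n) : Prop :=
  forall m (r s : 'I_m -> 'I_n), increasing r -> increasing s ->
    0 < \det (mxsub r s g).

(** Only finitely many minors are involved, so the neighbourhoods of [0] can be
    intersected. *)
Lemma near_totally_positive (R : realType) n (g : R -> 'M[R]_n) :
  (forall m (r s : 'I_m -> 'I_n), increasing r -> increasing s ->
    \forall q \near 0^'+, 0 < \det (mxsub r s (g q))) ->
  \forall q \near 0^'+, totally_positive (g q).
Proof.
move=> gP.
have : \forall q \near 0^'+, forall (m : 'I_n.+1) (r s : {ffun 'I_m -> 'I_n}),
    increasing r -> increasing s -> 0 < \det (mxsub r s (g q)).
  apply: filter_forall => m; apply: filter_forall => r; apply: filter_forall => s.
  have [[rI sI]|nI] := pselect (increasing r /\ increasing s).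
    by apply: filterS (gP _ _ _ rI sI) => q.
  by apply: filterE => q rI sI; case: nI.
apply: filterS => q gq m r s rI sI.
have mn : (m < n.+1)%N by rewrite ltnS (increasing_leq rI).
have := gq (Ordinal mn) (finfun r) (finfun s).
have E (f : 'I_m -> 'I_n) : finfun f = f :> (_ -> _).
  by apply/funext => a; rewrite ffunE.
by rewrite /= !E; apply.
Qed.

(** With truncated subtraction one of the summands vanishes: this is the square
    of the distance of [i] and [j]. *)
Definition gauss_exp (i j : nat) : nat := ((i - j) ^ 2 + (j - i) ^ 2)%N.

Definition gauss_mx (R : nzRingType) (n : nat) (q : R) : 'M[R]_n :=
  \matrix_(i, j) q ^+ gauss_exp i j.

Lemma gauss_expE i j : (gauss_exp i j + 2 * (i * j) = i ^ 2 + j ^ 2)%N.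
Proof.
rewrite /gauss_exp; have [ij|/ltnW ij] := leqP i j; rewrite -(subnK ij);
  set d := (_ - _)%N; nia.
Qed.

(** By [gauss_expE], the term of a permutation [p] in the minor has minimal degree
    when the sum of the [r a * s (p a)] is maximal, that is, only for [p = 1]. *)
Lemma gauss_mx_totally_positive (R : realType) n :
  \forall q \near 0^'+, totally_positive (gauss_mx n (q : R)).
Proof.
apply: near_totally_positive => m r s rI sI.
pose e (p : 'S_m) := (\sum_a gauss_exp (r a) (s (p a)))%N.
have eE p : (e p + 2 * (\sum_a r a * s (p a)) =
    \sum_(a < m) r a ^ 2 + \sum_(a < m) s a ^ 2)%N.
  rewrite [X in (_ = _ + X)%N](reindex_perm p) /e big_distrr /= -!big_split /=.
  by apply: eq_bigr => a _; rewrite gauss_expE.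
have : \forall q \near 0^'+, 0 < \sum_(p : 'S_m) (-1) ^+ p * (q : R) ^+ e p.
  apply: (@leading_term_gt0 _ _ (fun p : 'S_m => (-1) ^+ p) e 1%g).
    by rewrite odd_perm1.
  move=> p p1 _.
  have := rearrangement_lt (x := fun a => r a) (y := fun a => s a) rI sI p1.
  have := eE p; have /= := eE 1%g; under eq_bigr do rewrite perm1.
  by move=> /= E1 E2 E3; move: E1 E2 E3; lia.
apply: filterS => q; congr (0 < _); apply: eq_bigr => p _; congr (_ * _).
by rewrite /e expr_sum; apply: eq_bigr => a _; rewrite !mxE.
Qed.

(** The condition on [r] forces its values to be the first [m] rows. *)
Definition flag_positive (R : numDomainType) (n : nat) (g : 'M[R]_n) : Prop :=
  forall m (r s : 'I_m -> 'I_n), (forall a, r a = a :> nat) -> increasing s ->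
    0 < \det (mxsub r s g).

(** The exponents are chosen so that, in rows [r 0 < r 1 < ...], the cheapest
    choice of distinct columns is [0, 1, ...] in this order. *)
Definition lower_mx (R : nzRingType) (n : nat) (q : R) : 'M[R]_n :=
  \matrix_(i, j) if (j <= i)%N then q ^+ (j * (n - i)) else 0.

(** Expand the minor of the product along the rows of [lower_mx].  By
    [sum_weight_lt] the unique lowest term is the minor of [N] in its first [m]
    rows. *)
Lemma lower_mx_totally_positive (R : realType) n (N : 'M[R]_n) :
  flag_positive N ->
  \forall q \near 0^'+, totally_positive (lower_mx n q *m N).
Proof.
move=> N0; apply: near_totally_positive => m r s rI sI.
have mn := increasing_leq rI.
pose w : {ffun 'I_m -> 'I_n} := finfun (widen_ord mn).
have wE a : w a = a :> nat by rewrite ffunE.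
pose c (f : {ffun 'I_m -> 'I_n}) :=
  ([forall a, f a <= r a]%N)%:R * \det (mxsub f s N).
pose e (f : {ffun 'I_m -> 'I_n}) := (\sum_a f a * (n - r a))%N.
have : \forall q \near 0^'+, 0 < \sum_f c f * q ^+ e f.
  apply: (@leading_term_gt0 _ _ c e w).
    have wr : [forall a, w a <= r a]%N.
      by apply/forallP => a; rewrite wE increasing_geq.
    by rewrite /c wr mul1r N0.
  move=> f fw cf0.
  have -> : e w = (\sum_(a < m) a * (n - r a))%N.
    by apply: eq_bigr => a _; rewrite wE.
  apply: sum_weight_lt => //.
    apply: contrapT => fI; case/eqP: cf0; rewrite /c.
    by rewrite -rowsub_colsub det_rowsub_noninj ?mulr0.
  apply: contrapT => /forallNP fa; case/eqP: fw; apply/ffunP => a.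
  by apply/ord_inj; rewrite wE; apply/eqP; apply: contraT => /fa.
apply: filterS => q; congr (0 < _); rewrite mxsub_mul det_mulmx_sum.
apply: eq_bigr => f _; rewrite /c -rowsub_colsub mulrAC; congr (_ * _).
rewrite /e expr_sum.
have [/forallP fr|/forallPn[a fa]] := boolP [forall a, f a <= r a]%N.
  by rewrite mul1r; apply: eq_bigr => a _; rewrite !mxE fr.
by rewrite mul0r (bigD1 a) //= !mxE (negbTE fa) mul0r.
Qed.

(** * Flag minors *)

Lemma row_free_colsub (K : fieldType) m n (A : 'M[K]_(m, n)) :
  row_free A -> exists f : 'I_m -> 'I_n, \det (colsub f A) != 0.
Proof.
move=> Afree; have Afull : row_full A^T by rewrite /row_full mxrank_tr.
exists (fullrankfun Afull); have := fullrowsub_unit Afull.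
rewrite unitmxE unitfE -det_tr; congr (\det _ != 0).
by apply/matrixP => i j; rewrite !mxE.
Qed.

Lemma colsub_row_free (K : fieldType) m n (A : 'M[K]_(m, n)) (f : 'I_m -> 'I_n) :
  \det (colsub f A) != 0 -> row_free A.
Proof.
move=> Af; apply/row_freeP; exists (colsub f 1%:M *m invmx (colsub f A)).
by rewrite mulmxA mulmx_colsub mulmx1 mulmxV // unitmxE unitfE.
Qed.

Lemma row_free_rowsub (K : fieldType) m n (g : 'M[K]_n) (r : 'I_m -> 'I_n) :
  injective r -> g \in unitmx -> row_free (rowsub r g).
Proof.
move=> rI gu; apply/row_freeP; exists (colsub r (invmx g)).
rewrite -mxsub_mul mulmxV //; apply/matrixP => i j.
by rewrite !mxE (inj_eq rI).
Qed.

Definition flag_minors_ge0 (R : numDomainType) (n : nat) (M : 'M[R]_n) (m : nat) :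
    Prop :=
  forall r s : 'I_m -> 'I_n, (forall a, r a = a :> nat) -> increasing s ->
    0 <= \det (mxsub r s M).

(** The first rows of an invertible matrix are independent, hence have a nonzero
    minor, and [det_mulmx_gt0] applies to them. *)
Lemma mulmx_flag_positive (R : realType) n (M h : 'M[R]_n) :
  (forall m, flag_minors_ge0 M m) ->
  M \in unitmx -> totally_positive h -> flag_positive (M *m h).
Proof.
move=> M0 Mu h0 m r s rE sI.
have rI : injective r by move=> a b rab; apply: ord_inj; rewrite -!rE rab.
have [f Mf] := row_free_colsub (row_free_rowsub rI Mu).
rewrite mxsub_mul -[X in 0 < X]mul1r.
apply: (@det_mulmx_gt0 _ _ _ 1 _ _ f) => // t tI.
  by rewrite mul1r colsub_rowsub M0.
by rewrite rowsub_colsub h0.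
Qed.

(** In block form [M = (B, 1 ; (-1)^k, 0)], with blocks of sizes [k] and [n - k];
    the sign makes the flag minors nonnegative in the rows below [B]. *)
Definition completed_echelon (R : pzRingType) (k n : nat) (M : 'M[R]_n) : Prop :=
  (forall i j : 'I_n, (i < k)%N -> (n - k <= j)%N ->
     M i j = (j == (n - k + i)%N :> nat)%:R) /\
  (forall i j : 'I_n, (k <= i)%N ->
     M i j = (-1) ^+ k * (j == (i - k)%N :> nat)%:R).

(** Expand along the last row, which has a single nonzero entry, in column
    [m - k].  If the columns [0, ..., m - k] are all selected, removing the last
    of them leaves a smaller flag minor, and the signs cancel.  If not, let [c] be
    the first missing column: then row [k + c] of the minor vanishes. *)
Lemma flag_minors_ge0_up (R : numDomainType) k n (M : 'M[R]_n) m :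
  completed_echelon k M -> (k <= m)%N ->
  flag_minors_ge0 M m -> flag_minors_ge0 M m.+1.
Proof.
move=> [_ Mdown] km IH r s rE sI.
have bm : (m - k < m.+1)%N by lia.
pose b := Ordinal bm.
have [fixs|] := boolP [forall c : 'I_m.+1, (c <= m - k) ==> (s c == c :> nat)]%N.
  have sb : s b = b :> nat.
    by have /implyP/(_ (leqnn _))/eqP := forallP fixs b.
  rewrite (expand_det_row _ ord_max) (bigD1 b) //= big1 ?addr0; last first.
    move=> c cb; rewrite mxE Mdown rE //= -{1}[(m - k)%N]sb.
    case: eqP => [/val_inj/(increasing_inj sI) E|]; last by rewrite mulr0 mul0r.
    by rewrite E eqxx in cb.
  rewrite mxE Mdown rE //= sb eqxx mulr1 /cofactor mulrA -exprD.
  have -> : (k + (m + (m - k)) = m.*2)%N by lia.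
  rewrite -signr_odd odd_double mul1r.
  have -> : row' ord_max (col' b (mxsub r s M)) =
      mxsub (r \o lift ord_max) (s \o lift b) M.
    by apply/matrixP => i j; rewrite !mxE.
  apply: IH => [a|a c ac] /=; first by rewrite rE /= /bump leqNgt ltn_ord.
  by apply: sI; rewrite /= /bump; lia.
move=> nfix.
have {nfix} : exists c, (c <= m - k)%N &&
    [exists a : 'I_m.+1, (a == c :> nat) && (s a != c :> nat)].
  have /forallPn[c] := nfix; rewrite negb_imply => /andP[cm sc].
  by exists (val c); rewrite cm; apply/existsP; exists c; rewrite eqxx.
move=> /ex_minnP[c /andP[cm /existsP[a0 /andP[/eqP a0c sa0]]] cmin].
have im a : s a != c :> nat.
  have [ac|ca] := ltnP a c.
    have [->|sa] := eqVneq (s a : nat) a; first by rewrite neq_ltn ac.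
    have := cmin a; have -> /= : (a <= m - k)%N by lia.
    have -> : [exists b : 'I_m.+1, (b == a :> nat) && (s b != a :> nat)].
      by apply/existsP; exists a; rewrite eqxx.
    by move=> /(_ isT); lia.
  have := increasing_geq a0 sI.
  have [<-|aa0] := eqVneq a0 a; first by [].
  have /sI : (a0 < a)%N.
    by rewrite ltn_neqAle a0c ca -val_eqE in aa0 *; rewrite -a0c aa0.
  by lia.
have kc : (k + c < m.+1)%N by lia.
rewrite (expand_det_row _ (Ordinal kc)) big1 // => a _.
rewrite mxE Mdown rE /= ?leq_addr // addKn.
by rewrite (negbTE (im a)) mulr0 mul0r.
Qed.

(** A minor that uses a column [>= n - k + m] has a zero column.  Otherwise, append
    to it row [m] and column [n - k + m]: the new column is zero except for a last
    entry [1], so the value does not change. *)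
Lemma flag_minors_ge0_down (R : numDomainType) k n (M : 'M[R]_n) m :
  (k <= n)%N -> completed_echelon k M -> (m < k)%N ->
  flag_minors_ge0 M m.+1 -> flag_minors_ge0 M m.
Proof.
move=> kn [Mup _] mk IH r s rE sI.
have [/existsP[b sb]|/existsPn sb] := boolP [exists b, (n - k + m <= s b)%N].
  rewrite (expand_det_col _ b) big1 // => a _; have am := ltn_ord a.
  rewrite mxE Mup ?rE; [|lia..].
  by rewrite (_ : (s b == _ :> nat) = false) ?mul0r //; lia.
have nm : (n - k + m < n)%N by lia.
pose s' (a : 'I_m.+1) := if unlift ord_max a is Some b then s b else Ordinal nm.
have mn : (m.+1 <= n)%N by lia.
have s'I : increasing s'.
  move=> a b; rewrite /s'; case: unliftP => [a'|] ->; case: unliftP => [b'|] -> /=.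
  - by rewrite /bump !(leqNgt m) !ltn_ord => /sI.
  - by move=> _; have := sb a'; rewrite -ltnNge.
  - by rewrite /bump (leqNgt m) ltn_ord add0n ltnNge ltnW.
  - by rewrite ltnn.
have := IH (widen_ord mn) s' (fun=> erefl) s'I.
rewrite (expand_det_col _ ord_max) (bigD1 ord_max) //= big1 ?addr0; last first.
  move=> a am; have al := ltn_ord a; rewrite mxE /s' unlift_none Mup /=; [|lia..].
  have am' : (a : nat) != m by exact: am.
  by rewrite (_ : (_ == _ :> nat) = false) ?mul0r //; lia.
rewrite mxE /s' unlift_none Mup /= ?eqxx ?mul1r; [|lia..].
rewrite /cofactor -signr_odd addnn odd_double mul1r.
congr (0 <= \det _); apply/matrixP => a b; rewrite !mxE liftK.
by congr (M _ _); apply: ord_inj; rewrite rE /= /bump leqNgt ltn_ord.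
Qed.

Lemma completed_echelon_flag_ge0 (R : numDomainType) k n (M : 'M[R]_n) m :
  (k <= n)%N -> completed_echelon k M -> flag_minors_ge0 M k ->
  flag_minors_ge0 M m.
Proof.
move=> kn Mc Mk; have [|/ltnW mk] := leqP k m.
  elim: m => [|m IH]; first by rewrite leqn0 => /eqP <-.
  rewrite leq_eqVlt => /orP[/eqP <- //|km].
  exact: flag_minors_ge0_up Mc km (IH km).
rewrite -(subKn mk); elim: (k - m)%N (leq_subr m k) => [|d IH] dk.
  by rewrite subn0.
apply: (flag_minors_ge0_down kn Mc); first by lia.
by rewrite (_ : (k - d.+1).+1 = k - d)%N; [apply: IH; lia | lia].
Qed.

(** If [M *m u = 0], the rows from [k] on give [u j = 0] for [j < n - k], and then
    the first rows give the remaining coordinates. *)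
Lemma completed_echelon_unit (K : fieldType) k n (M : 'M[K]_n) :
  completed_echelon k M -> M \in unitmx.
Proof.
move=> [Mup Mdown]; rewrite -unitmx_tr -row_free_unit -kermx_eq0.
apply/rowV0P => u /sub_kermxP uM.
have uME i : \sum_j u 0 j * M i j = 0.
  have /rowP/(_ i) := uM; rewrite !mxE => E; rewrite -[RHS]E.
  by apply: eq_bigr => j _; rewrite mxE.
have low (j : 'I_n) : (j < n - k)%N -> u 0 j = 0.
  move=> jn; have kj : (k + j < n)%N by lia.
  have := uME (Ordinal kj); rewrite (bigD1 j) //= big1 ?addr0.
    rewrite Mdown /= ?leq_addr // addKn eqxx mulr1 => /eqP.
    by rewrite mulf_eq0 signr_eq0 orbF => /eqP.
  move=> l lj; rewrite Mdown /= ?leq_addr // addKn.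
  by rewrite -val_eqE /= in lj; rewrite (negbTE lj) !mulr0.
apply/rowP => j; rewrite [RHS]mxE; have [/low//|jn] := ltnP j (n - k).
have kj : (j - (n - k) < n)%N by have := ltn_ord j; lia.
have jk : (j - (n - k) < k)%N by have := ltn_ord j; lia.
have := uME (Ordinal kj); rewrite (bigD1 j) //= big1 ?addr0.
  by rewrite Mup //= subnKC // eqxx mulr1.
move=> l lj; have [/low ->|ln] := ltnP l (n - k); first by rewrite mul0r.
rewrite -val_eqE /= in lj; rewrite Mup //= subnKC // (negbTE lj) mulr0 //.
Qed.

(** * Points of the Grassmannian as row spans *)

Lemma row_span_mul_sub (K : fieldType) p k n (C : 'M[K]_(p, k))
    (A : 'M[K]_(k, n)) :
  (row_span (C *m A) <= row_span A)%VS.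
Proof.
apply/span_subvP => _ /mapP[i _ ->]; rewrite row_mul mulmx_sum_row.
apply: memv_suml => j _; apply/memvZ/memv_span.
by apply/mapP; exists j; rewrite ?mem_enum.
Qed.

Lemma row_span_mulmx_unit (K : fieldType) k n (C : 'M[K]_k) (A : 'M[K]_(k, n)) :
  C \in unitmx -> row_span (C *m A) = row_span A.
Proof.
move=> Cu; apply/subv_anti; rewrite row_span_mul_sub /=.
by rewrite -{1}(mulKmx Cu A) row_span_mul_sub.
Qed.

(** The rows of [C] are coordinates of the rows of [A] on those of [B]. *)
Lemma row_span_sub_mulmx (K : fieldType) p k n (A : 'M[K]_(p, n))
    (B : 'M[K]_(k, n)) :
  (row_span A <= row_span B)%VS -> exists C, A = C *m B.
Proof.
move=> AB; pose t := [tuple row i B | i < k].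
exists (\matrix_(i, j) coord t j (row i A)); apply/row_matrixP => i.
have iA : row i A \in <<t>>%VS.
  by apply: (subvP AB); apply/memv_span/mapP; exists i; rewrite ?mem_enum.
rewrite row_mul mulmx_sum_row [LHS](coord_span iA); apply: eq_bigr => j _.
by rewrite !mxE -tnth_nth tnth_mktuple.
Qed.

Lemma gr_act_e_span (K : fieldType) k n (g : 'M[K]_n) (r : 'I_k -> 'I_n) :
  (forall a, r a = a :> nat) ->
  gr_act_vs (e_span K k n) g = row_span (rowsub r g).
Proof.
move=> rE; rewrite /gr_act_vs /e_span limg_span; apply: eq_span => v.
apply/mapP/mapP => [[_ /mapP[i ik ->] ->]|[a _ ->]].
  rewrite mem_enum inE in ik; exists (Ordinal ik); rewrite ?mem_enum //.
  rewrite lfunE /= -rowE; apply/rowP => j; rewrite !mxE; congr (g _ _).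
  by apply: ord_inj; rewrite rE.
exists (delta_mx 0 (r a)).
  by apply/mapP; exists (r a); rewrite // mem_enum inE rE.
by rewrite lfunE /= -rowE; apply/rowP => j; rewrite !mxE.
Qed.

Lemma gr_span_eq (K : fieldType) k n (A B : full_rank_mx K k n) :
  gr_span A = gr_span B -> exists C, val A = C *m val B.
Proof.
by move=> /(congr1 (@gr_vs _ _ _)) /= AB; apply: row_span_sub_mulmx; rewrite AB.
Qed.

Lemma full_rank_row_free (K : fieldType) k n (A : full_rank_mx K k n) :
  row_free (val A).
Proof. by case: A => A /= /set_mem. Qed.

Definition to_full_rank (K : fieldType) k n (A : 'M[K]_(k, n)) (Af : row_free A) :
  full_rank_mx K k n := SigSub (mem_set Af : A \in full_rank_mx K k n).

(** The predicate [P] lets one statement serve for positivity and for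
    nonnegativity, with any scalar factor. *)
Lemma pluckerE (K : fieldType) k n (A : 'M[K]_(k, n)) (P : K -> Prop) :
  (forall (I : {set 'I_n}) (hI : #|I| = k), P (plucker A hI)) <->
  (forall s, increasing s -> P (\det (colsub s A))).
Proof.
split=> AP => [s sI|I hI]; last exact/AP/subset_nth_increasing.
have := AP _ (card_imset_ord (increasing_inj sI)); rewrite /plucker.
rewrite (_ : colsub _ A = colsub s A) //.
by apply/matrixP => i j; rewrite !mxE subset_nth_imset.
Qed.

Lemma row_free_increasing (K : fieldType) k n (A : 'M[K]_(k, n)) :
  row_free A -> exists2 s, increasing s & \det (colsub s A) != 0.
Proof.
move=> /row_free_colsub[f Af].
have /injective_sort[s [p [sI fE]]] : injective f.
  by apply/injectiveP; apply: contraNT Af => /injectiveP fI;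
    rewrite det_colsub_noninj.
exists s => //; move: Af.
have -> : colsub f A = colsub (s \o p) A.
  by apply/matrixP => i j; rewrite !mxE fE.
by rewrite det_colsub_perm mulf_eq0 signr_eq0.
Qed.

Lemma det_colsub_mul (K : comPzRingType) k n (C : 'M[K]_k) (A : 'M[K]_(k, n))
    (s : 'I_k -> 'I_n) :
  \det (colsub s (C *m A)) = \det C * \det (colsub s A).
Proof. by rewrite -mulmx_colsub det_mulmx. Qed.

(** Two nonzero complex numbers lie on one ray from the origin exactly when
    [`|x| * y = `|y| * x].  This form does not mention the scalar, and it holds
    for one representing matrix if and only if it holds for all. *)
Lemma Gr_ge0P (K : numFieldType) k n (A : full_rank_mx K k n) :
  Gr_ge0 (gr_span A) <->
  forall s t : 'I_k -> 'I_n, increasing s -> increasing t ->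
    `|\det (colsub s (val A))| * \det (colsub t (val A)) =
    `|\det (colsub t (val A))| * \det (colsub s (val A)).
Proof.
split=> [[B [c [/gr_span_eq[C ->] c0 Bc]]] s t sI tI|AP].
  have {}Bc := (pluckerE _ (fun x => 0 <= c * x)).1 Bc.
  rewrite !det_colsub_mul !normrM.
  set x := \det (colsub s _); set y := \det (colsub t _).
  suff xy : `|x| * y = `|y| * x by rewrite mulrACA xy mulrACA.
  have cc : `|c| * c != 0 by rewrite mulf_neq0 ?normr_eq0.
  apply: (mulfI cc); rewrite mulrACA [RHS]mulrACA -!normrM.
  by rewrite !ger0_norm ?Bc // mulrC.
have /row_free_increasing[s sI As] := full_rank_row_free A.
exists A, (\det (colsub s (val A)))^-1; split; rewrite ?invr_eq0 //.
apply/(pluckerE _ (fun x => 0 <= _ * x)) => t tI.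
have := AP s t sI tI; set x := \det _; set y := \det _ => xy.
have -> : x^-1 * y = `|y| / `|x|.
  have x0 : `|x| != 0 by rewrite normr_eq0.
  apply: (mulfI As); rewrite mulVKf //; apply: (mulfI x0).
  by rewrite xy mulrCA [`|x| * _]mulrC divfK // mulrC.
by rewrite divr_ge0.
Qed.

(** * The topology of the Grassmannian *)

Lemma continuous_det_colsub (K : numFieldType) k n (s : 'I_k -> 'I_n) :
  continuous (fun A : 'M[K]_(k, n) => \det (colsub s A)).
Proof.
have prod_cont (p : 'S_k) :
    continuous (fun A : 'M[K]_(k, n) => \prod_i colsub s A i (p i)).
  apply: (@continuous_big K _ (@GRing.mul K) 1 xpredT (@mul_continuous K) _ _
    (fun i A => colsub s A i (p i))) => i _.
  have -> : (fun A : 'M[K]_(k, n) => colsub s A i (p i)) =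
      (fun A => A i (s (p i))).
    by apply/funext => A; rewrite mxE.
  exact: coord_continuous.
apply: (continuous_big (op := +%R)) => [|p _ A]; first exact: add_continuous.
exact: (cvgMl_tmp (prod_cont p A)).
Qed.

Lemma open_GrE (K : numFieldType) k n (S : set (Gr K k n)) :
  open S = Gr_open S.
Proof. by []. Qed.

(** The preimage in the space of full rank matrices is cut out by the continuous
    equations of [Gr_ge0P]. *)
Lemma closed_Gr_ge0 (K : numFieldType) k n : closed (@Gr_ge0 K k n).
Proof.
pose d (s t : 'I_k -> 'I_n) (A : 'M[K]_(k, n)) : K :=
  `|\det (colsub s A)| * \det (colsub t A)
  - `|\det (colsub t A)| * \det (colsub s A).
pose Z := \bigcap_(st in [set st | increasing st.1 /\ increasing st.2])
  d st.1 st.2 @^-1` [set 0].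
have Zcl : closed Z.
  apply: closed_bigI => -[s t] _ /=.
  have dc : continuous (d s t).
    have c := @continuous_det_colsub K k n; move=> A.
    exact: (cvgB (cvgM (cvg_norm (c s A)) (c t A))
                 (cvgM (cvg_norm (c t A)) (c s A))).
  apply: ((continuous_closedP _).1 dc); apply: accessible_closed_set1.
  exact/hausdorff_accessible/norm_hausdorff.
have E : @gr_span K k n @^-1` @Gr_ge0 K k n = val @^-1` Z.
  apply/seteqP; split => [A /Gr_ge0P AP [s t] [/= sI tI]|A AZ].
    by rewrite /d AP // subrr.
  apply/Gr_ge0P => s t sI tI.
  by have /= /eqP := AZ (s, t) (conj sI tI); rewrite /d subr_eq0 => /eqP.
rewrite -openC open_GrE /Gr_open -preimage_setC E openC.
exact: ((continuous_closedP _).1 (@initial_continuous _ _ _)).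
Qed.

(** The quotient map [gr_span] is continuous, so it suffices to approximate a
    representing matrix. *)
Lemma closure_gr_span (K : numFieldType) k n (S : set (Gr K k n))
    (A : full_rank_mx K k n) :
  (forall U, nbhs (val A) U ->
     exists B : full_rank_mx K k n, U (val B) /\ S (gr_span B)) ->
  closure S (gr_span A).
Proof.
move=> AS V; rewrite nbhsE => -[W [Wo WA] WV].
rewrite open_GrE /Gr_open in Wo; case: Wo => U Uo UW.
have /AS[B [UB SB]] : nbhs (val A) U.
  apply: open_nbhs_nbhs; split => //.
  by have : (set_val @^-1` U) A by rewrite UW.
exists (gr_span B); split => //; apply: WV.
by have : (@gr_span K k n @^-1` W) B by rewrite -UW.
Qed.

(* Inference of the topology of [R[i]] starts from its [numFieldType] structure. *)
Local Notation CC R := (R[i] : numFieldType).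

Lemma real_complex_continuous (R : realType) :
  continuous (real_complex R : R -> CC R).
Proof.
move=> x; apply/cvgrPdist_lt => e e0.
have /complex_realP[r er] : e \is Num.real by rewrite gtr0_real.
have r0 : 0 < r by rewrite er ltcR in e0.
have : \forall t \near x, ball x r t by exact: nbhsx_ballx.
apply: filterS => t; rewrite /ball /= => xt.
rewrite -rmorphB normc_def /= expr0n addr0 sqrtr_sqr.
by rewrite er ltcR.
Qed.

Lemma gauss_mx0 (R : nzRingType) n : gauss_mx n (0 : R) = 1%:M.
Proof.
apply/matrixP => i j; rewrite !mxE expr0n /gauss_exp; congr (_%:R).
by rewrite -val_eqE /=; congr nat_of_bool; apply/eqP/eqP => //; lia.
Qed.

(** The limit is [A], as [gauss_mx n 0] is the identity matrix. *)
Lemma cvg_mulmx_gauss (R : realType) k n (A : 'M[CC R]_(k, n)) :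
  A *m map_mx (real_complex R) (gauss_mx n q) @[q --> 0^'+] --> A.
Proof.
apply/cvg_ballP => e e0.
suff : \forall q \near 0^'+, forall i j,
    ball (A i j) e ((A *m map_mx (real_complex R) (gauss_mx n q)) i j).
  by apply: filterS => q Aq; split.
apply: filter_forall => i; apply: filter_forall => j; apply: cvg_ball => //.
rewrite -[in X in _ --> X](mulmx1 A) -(map_mx1 (real_complex R)) -gauss_mx0 mxE.
under eq_cvg do rewrite mxE.
apply: (cvg_big (op := +%R)) => [|l _]; first exact: add_continuous.
apply: cvgMl_tmp; rewrite !mxE; under eq_cvg do rewrite !mxE.
apply: cvg_at_right_filter.
apply: (@cvg_comp _ _ _ (fun q : R => q ^+ gauss_exp l j) (real_complex R)).
  exact: exprn_continuous.
exact: real_complex_continuous.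
Qed.

(** * The inclusions between the three sets *)

Lemma totally_positive_unit (R : numFieldType) n (g : 'M[R]_n) :
  totally_positive g -> g \in unitmx.
Proof.
move=> g0; have := g0 n id id (fun _ _ => id) (fun _ _ => id).
by rewrite mxsub_id unitmxE unitfE => /gt_eqF ->.
Qed.

Lemma minor_increasing (K : fieldType) n m (g : 'M[K]_n) (r s : 'I_m -> 'I_n)
    (rI : increasing r) (sI : increasing s) :
  minor g (card_imset_ord (increasing_inj rI))
    (card_imset_ord (increasing_inj sI))
  = \det (mxsub r s g).
Proof.
by congr (\det _); apply/matrixP => i j; rewrite !mxE !subset_nth_imset.
Qed.

Lemma det_mxsub_real_complex (R : rcfType) m p n (g : 'M[R]_(p, n))
    (r : 'I_m -> 'I_p) (s : 'I_m -> 'I_n) :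
  \det (mxsub r s (map_mx (real_complex R) g)) = (\det (mxsub r s g))%:C%C.
Proof. by rewrite -map_mxsub det_map_mx. Qed.

(** Multiply on the right by [gauss_mx n q] and let [q] tend to [0]. *)
Lemma Gr_ge0_sub_closure_gt0 (R : realType) k n : (k <= n)%N ->
  @Gr_ge0 R[i] k n `<=` closure (@Gr_gt0 R[i] k n).
Proof.
move=> kn _ [A [c [-> c0 Ac]]]; apply: closure_gr_span => U AU.
have {}Ac := (pluckerE _ (fun x => 0 <= c * x)).1 Ac.
have Uq : \forall q \near 0^'+,
    U (val A *m map_mx (real_complex R) (gauss_mx n q)).
  exact: (@cvg_mulmx_gauss R k n (val A) U AU).
have [q [{}Uq hq]] := filter_ex (filterI Uq (gauss_mx_totally_positive R n)).
set h := map_mx _ _ in Uq.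
have [f Af] := row_free_colsub (full_rank_row_free A).
have pos s : increasing s -> 0 < c * \det (colsub s (val A *m h)).
  move=> sI; rewrite -mulmx_colsub; apply: (det_mulmx_gt0 (f := f)) => // t tI.
  by rewrite rowsub_colsub det_mxsub_real_complex ltcR hq.
have Bfree : row_free (val A *m h).
  apply: (@colsub_row_free _ _ _ _ (widen_ord kn)).
  have /pos : increasing (widen_ord kn) by [].
  by move/gt_eqF; rewrite mulf_eq0 (negbTE c0) => /= ->.
exists (to_full_rank Bfree); split => //.
exists (to_full_rank Bfree), c; split => //.
exact/(pluckerE _ (fun x => 0 < c * x)).
Qed.

Lemma e_GL_ge0_sub_Gr_ge0 (R : rcfType) k n : (k <= n)%N ->
  @e_GL_ge0 R k n `<=` @Gr_ge0 R[i] k n.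
Proof.
move=> kn X [g [gu g0] XE]; pose r := widen_ord kn.
have rI : increasing r by [].
pose h := map_mx (real_complex R) g.
have hu : h \in unitmx by rewrite map_unitmx.
have Afree := row_free_rowsub (increasing_inj rI) hu.
exists (to_full_rank Afree), 1; split; rewrite ?oner_neq0 //.
  by apply: val_inj; rewrite /= XE; apply: gr_act_e_span.
apply/(pluckerE _ (fun x => 0 <= 1 * x)) => s sI; rewrite mul1r /=.
by rewrite colsub_rowsub det_mxsub_real_complex lecR -(minor_increasing g rI sI).
Qed.

(** Dividing by the block of the last [k] columns makes that block the identity
    and turns each maximal minor into a quotient of two maximal minors of [A].
    All these quotients are real, and so are the entries, as each entry is itself
    a minor: that of the last [k] columns with one of them exchanged. *)
Lemma real_representative (R : rcfType) k n (A : 'M[R[i]]_(k, n)) (c : R[i]) :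
  (k <= n)%N ->
  (forall s, increasing s -> 0 < c * \det (colsub s A)) ->
  exists A0 : 'M[R]_(k, n), [/\
    exists2 C, C \in unitmx & map_mx (real_complex R) A0 = C *m A,
    forall (a : 'I_k) (j : 'I_n), (n - k <= j)%N ->
      A0 a j = (j == (n - k + a)%N :> nat)%:R &
    forall s, increasing s -> 0 < \det (colsub s A0)].
Proof.
move=> kn Ac.
have lastP (a : 'I_k) : (n - k + a < n)%N by have := ltn_ord a; lia.
pose w a := Ordinal (lastP a).
have wI : increasing w by move=> a b ab; rewrite /= ltn_add2l.
pose D := colsub w A.
have c0 : c != 0.
  by have := Ac w wI; apply: contraTneq => ->; rewrite mul0r ltxx.
have D0 : \det D != 0.
  by have := Ac w wI; apply: contraTneq => E; rewrite E mulr0 ltxx.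
have Du : D \in unitmx by rewrite unitmxE unitfE.
pose A' := invmx D *m A.
have A'det f : \det (colsub f A') = (c * \det (colsub f A)) / (c * \det D).
  by rewrite det_colsub_mul det_inv -mulf_div divff // mul1r mulrC.
have A'w : colsub w A' = 1%:M by rewrite -mulmx_colsub mulVmx.
have A'real a j : A' a j \is Num.real.
  pose f b := if b == a then j else w b.
  have -> : A' a j = \det (colsub f A').
    rewrite (expand_det_row _ a) (bigD1 a) //= big1 ?addr0; last first.
      move=> b ba; have /matrixP/(_ a b) := A'w.
      rewrite mxE [1%:M _ _]mxE eq_sym (negbTE ba) => E.
      by rewrite [X in X * _]mxE /f (negbTE ba) E mul0r.
    rewrite [X in _ = X * _]mxE /f eqxx /cofactor -signr_odd addnn odd_double.
    rewrite mul1r.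
    rewrite -[LHS]mulr1; congr (_ * _); rewrite -(det1 _ k.-1); congr (\det _).
    apply/matrixP => b d; have /matrixP/(_ (lift a b) (lift a d)) := A'w.
    rewrite mxE [1%:M _ _]mxE (inj_eq lift_inj) => E.
    rewrite [LHS]mxE [RHS]mxE [RHS]mxE [RHS]mxE /f.
    by rewrite (eq_sym (lift a d)) (negbTE (neq_lift _ _)) E.
  rewrite A'det realM //; last by rewrite realV gtr0_real // Ac.
  have [/injectiveP fI|/injectiveP fI] := boolP (injectiveb f); last first.
    by rewrite det_colsub_noninj // mulr0 real0.
  have [s [p [sI fE]]] := injective_sort fI.
  have -> : colsub f A = colsub (s \o p) A.
    by apply/matrixP => i l; rewrite !mxE fE.
  by rewrite det_colsub_perm mulrCA realM ?realX ?realN ?real1 // gtr0_real ?Ac.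
have A0E : map_mx (real_complex R) (map_mx (@complex.Re R) A') = A'.
  by apply/matrixP => i j; rewrite [LHS]mxE mxE RRe_real.
exists (map_mx (@complex.Re R) A'); split.
- by exists (invmx D); rewrite ?unitmx_inv.
- move=> a j jn; have jk : (j - (n - k) < k)%N by have := ltn_ord j; lia.
  have jw : j = w (Ordinal jk) by apply: ord_inj; rewrite /= subnKC.
  have /matrixP/(_ a (Ordinal jk)) := A'w.
  rewrite mxE -jw => Aj; rewrite mxE Aj mxE -val_eqE /=.
  rewrite -[in RHS](subnKC jn) eqn_add2l eq_sym.
  by case: eqP.
- move=> s sI; have := A'det s; rewrite -{1}A0E.
  by rewrite det_mxsub_real_complex -ltcR => ->; rewrite divr_gt0 ?Ac.
Qed.

(** The approximating points [A0 *m h] are the spans of the first [k] rows of the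
    totally positive matrices [lower_mx n t *m (M *m h)]. *)
Lemma Gr_gt0_sub_closure_e_GL (R : realType) k n : (k <= n)%N ->
  @Gr_gt0 R[i] k n `<=` closure (@e_GL_ge0 R k n).
Proof.
move=> kn _ [A [c [-> c0 Ac]]].
have {c0}Ac := (pluckerE _ (fun x => 0 < c * x)).1 Ac.
have [A0 [[C Cu A0E] A0w A0pos]] := real_representative kn Ac.
have A0free : row_free (map_mx (real_complex R) A0).
  rewrite A0E /row_free mxrankMfree ?full_rank_row_free //.
  by rewrite -/(row_free C) row_free_unit.
have -> : gr_span A = gr_span (to_full_rank A0free).
  by apply: val_inj; rewrite /= A0E row_span_mulmx_unit.
apply: closure_gr_span => U /= AU.
have Uq : \forall q \near 0^'+,
    U (map_mx (real_complex R) A0 *m map_mx (real_complex R) (gauss_mx n q)).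
  exact: (@cvg_mulmx_gauss R k n (map_mx (real_complex R) A0) U AU).
have [q [{}Uq hq]] := filter_ex (filterI Uq (gauss_mx_totally_positive R n)).
set h := gauss_mx n q in hq Uq.
pose M : 'M[R]_n := \matrix_(i, j)
  if insub (val i) : option 'I_k is Some a then A0 a j
  else (-1) ^+ k * (j == (i - k)%N :> nat)%:R.
pose r := widen_ord kn.
have rE a : r a = a :> nat by [].
have rI : injective r by apply: increasing_inj.
have Mr : rowsub r M = A0.
  apply/matrixP => a j; rewrite !mxE.
  case: insubP => [b _ /= ba|/negP[]]; last exact: (ltn_ord a).
  by congr (A0 _ _); apply: ord_inj.
have Mc : completed_echelon k M.
  split=> i j ki; last by rewrite mxE insubF // ltnNge ki.
  by move=> jn; rewrite mxE; case: insubP => [b _ /= <-|/negP[]//]; rewrite A0w.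
have Mk : flag_minors_ge0 M k.
  move=> r' s r'E sI; suff -> : mxsub r' s M = colsub s A0 by rewrite ltW ?A0pos.
  rewrite -Mr; apply/matrixP => a b; rewrite mxE [RHS]mxE [RHS]mxE.
  by congr (M _ _); apply: ord_inj; rewrite r'E.
have Mh : flag_positive (M *m h).
  apply: mulmx_flag_positive hq; last exact: completed_echelon_unit Mc.
  by move=> m; apply: completed_echelon_flag_ge0 Mc Mk.
have [t gpos] := filter_ex (lower_mx_totally_positive Mh).
set g := _ *m _ in gpos; have gu := totally_positive_unit gpos.
have hu : map_mx (real_complex R) h \in unitmx.
  by rewrite map_unitmx totally_positive_unit.
have Bfree : row_free (map_mx (real_complex R) A0 *m map_mx (real_complex R) h).
  by rewrite /row_free mxrankMfree ?row_free_unit // (eqP A0free).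
exists (to_full_rank Bfree); split => //.
exists g.
  by split=> // m I J hI hJ; apply/ltW/gpos; exact: subset_nth_increasing.
rewrite (gr_act_e_span _ rE) /=.
(* The first [k] rows of [lower_mx] vanish outside the first [k] columns, so the
   first [k] rows of [g] are those of [M *m h] up to the invertible block [L]. *)
pose L := mxsub r r (lower_mx n t).
have gL : rowsub r g = L *m (A0 *m h).
  rewrite -Mr mul_rowsub_mx /g -mul_rowsub_mx.
  have -> : rowsub r (lower_mx n t) = L *m rowsub r 1%:M.
    apply/matrixP => a j; rewrite mxE [RHS]mxE.
    have [jk|kj] := ltnP j k.
      have [b0 ->] : exists b0, j = r b0 by exists (Ordinal jk); apply: ord_inj.
      rewrite (bigD1 b0) //= big1 ?addr0; last first.
        move=> b bb0; rewrite [X in _ * X]mxE [X in _ * X]mxE (inj_eq rI).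
        by rewrite (negbTE bb0) mulr0.
      by rewrite !mxE eqxx mulr1.
    rewrite big1 => [|b _]; last first.
      rewrite [X in _ * X]mxE [X in _ * X]mxE (_ : (r b == j) = false) ?mulr0 //.
      by apply/negP => /eqP rbj; move: kj; rewrite -rbj /= leqNgt ltn_ord.
    by rewrite mxE leqNgt (leq_trans (ltn_ord a) kj).
  by rewrite -mulmxA mul_rowsub_mx mul1mx.
have Lu : L \in unitmx.
  have rgfree := row_free_rowsub rI gu.
  rewrite -row_free_unit /row_free eqn_leq rank_leq_row /=.
  by rewrite -{1}(eqP rgfree) gL mxrankM_maxl.
by rewrite -map_mxsub gL !map_mxM row_span_mulmx_unit // map_unitmx.
Qed.

Theorem theorem3p6 (R : realType) (k n : nat)
    (hk : (1 <= k)%N) (hkn : (k <= n)%N) :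
  @Gr_ge0 R[i] k n = closure (@Gr_gt0 R[i] k n) /\
  closure (@Gr_gt0 R[i] k n) = closure (@e_GL_ge0 R k n).
Proof.
have ge0_closed : closure (@Gr_ge0 R[i] k n) = @Gr_ge0 R[i] k n.
  by rewrite -((closure_id _).1 (@closed_Gr_ge0 _ k n)).
have gt0_ge0 : @Gr_gt0 R[i] k n `<=` @Gr_ge0 R[i] k n.
  by move=> X [A [c [XA c0 Ac]]]; exists A, c; split=> // I hI; exact/ltW.
have E : @Gr_ge0 R[i] k n = closure (@Gr_gt0 R[i] k n).
  apply/seteqP; split; first exact: Gr_ge0_sub_closure_gt0.
  by rewrite -ge0_closed; exact: closureS.
split=> //; apply/seteqP; split.
  rewrite [X in _ `<=` X]((closure_id _).1 (@closed_closure _ _)).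
  exact/closureS/Gr_gt0_sub_closure_e_GL.
by rewrite -E -ge0_closed; exact/closureS/e_GL_ge0_sub_Gr_ge0.
Qed.
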